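(* Let $n$ and $k$ be positive integers with $n\ge 2k^3$. For any real numbers $x_1,\dots,x_n$ with $\sum_{i=1}^n x_i\ge 0$, the number of $k$-element subsets $S\subseteq\{1,\dots,n\}$ with $\sum_{i\in S}x_i\ge 0$ is at least $\binom{n-1}{k-1}$. *)

(* Defs.v *)
From HB Require Import structures.
From mathcomp Require Export all_boot all_order all_algebra.
From mathcomp Require Export reals.

Set Implicit Arguments.
Unset Strict Implicit.
Unset Printing Implicit Defensive.

(* Main.v *)
(** Let [x i0] be the largest value.  By Markov's inequality applied to the
    nonnegative numbers [x i0 - x j], at most [n * 'C(n - 2, k - 2) / k] of the
    [k]-sets containing [i0] have a negative sum.  If there is such a set [A],
    its complement has nonnegative sum, and keeps it when fewer than [k]
    smallest elements are dropped to make its size a multiple of [k].  When [k]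
    divides the size, the desired bound holds by induction on the quotient: for
    a fixed element [i], apply the induction hypothesis to the complement of each
    negative [k]-set containing [i] and count disjoint pairs.  Hence at least
    ['C(n - 2k, k - 1)] nonnegative [k]-sets avoid [i0], and for [n >= 2k^3] this
    is at least the number of negative [k]-sets containing [i0]. *)
Require Import Defs.
From mathcomp Require Import all_boot all_order all_algebra.
From mathcomp Require Import reals.
From mathcomp Require Import zify lra.

Import Order.TTheory GRing.Theory Num.Theory.

Local Open Scope ring_scope.

Section SubsetCounting.
Set Implicit Arguments.
Unset Strict Implicit.
Variable T : finType.
Implicit Types (A B G S : {set T}) (k : nat).

(** Adding [B] is a bijection from the [k]-subsets of [G :\: B] onto these sets. *)
Lemma card_draws_between B G k : B \subset G ->
  #|[set A : {set T} | [&& B \subset A, A \subset G & #|A| == (#|B| + k)%N]]|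
    = 'C(#|G| - #|B|, k).
Proof.
move=> sBG; rewrite -cardsDS // -cards_draws.
have inj : {in [set S : {set T} | S \subset G :\: B & #|S| == k] &,
    injective (fun S => B :|: S)}.
  move=> S S'; rewrite !inE !subsetD => /andP[/andP[_ dS] _] /andP[/andP[_ dS'] _].
  move=> /(congr1 (fun A => A :\: B)); rewrite !setDUl setDv !set0U.
  by move/setDidPl: dS => ->; move/setDidPl: dS' => ->.
rewrite -(card_in_imset inj); apply: eq_card => A; rewrite !inE.
apply/idP/imsetP => [/and3P[sBA sAG /eqP cA]|[S]].
  exists (A :\: B); last by rewrite setDE setUIr setUCr setIT (setUidPr sBA).
  by rewrite inE setSD //= cardsDS // cA addKn.
rewrite inE subsetD => /andP[/andP[sSG dSB] /eqP cS] ->.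
rewrite subsetUl subUset sBG sSG /= cardsU cS.
by rewrite setIC (disjoint_setI0 dSB) cards0 subn0.
Qed.

Lemma card_draws_mem G k i : i \in G ->
  #|[set A : {set T} | [&& i \in A, A \subset G & #|A| == k.+1]]|
    = 'C(#|G|.-1, k).
Proof.
move=> iG; have /card_draws_between h : [set i] \subset G by rewrite sub1set.
rewrite -subn1 -(cards1 i) -h; apply: eq_card => A.
by rewrite !inE sub1set cards1.
Qed.

Lemma card_draws_mem2 G k i j : i \in G -> j \in G -> i != j ->
  #|[set A : {set T} | [&& i \in A, j \in A, A \subset G & #|A| == k.+2]]|
    = 'C(#|G| - 2, k).
Proof.
move=> iG jG nij.
have /card_draws_between h : [set i; j] \subset G by rewrite subUset !sub1set iG.
have c2 : #|[set i; j]| = 2%N by rewrite cards2 nij.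
rewrite -[X in (_ - X)%N]c2 -h c2; apply: eq_card => A.
by rewrite !inE subUset !sub1set -!andbA.
Qed.

End SubsetCounting.

Section NonnegativeSums.
Set Implicit Arguments.
Unset Strict Implicit.
Variables (R : realDomainType) (T : finType) (x : T -> R).
Implicit Types (A B G S : {set T}) (k r q : nat).

Definition nneg_sets G k :=
  [set S : {set T} | [&& S \subset G, #|S| == k & 0 <= \sum_(i in S) x i]].

Definition nneg_sets_at i G k :=
  [set S : {set T} | [&& i \in S, S \subset G, #|S| == k & 0 <= \sum_(i in S) x i]].

Definition neg_sets_at i G k :=
  [set S : {set T} | [&& i \in S, S \subset G, #|S| == k & \sum_(i in S) x i < 0]].

Lemma card_nneg_neg_at i G k : i \in G ->
  (#|nneg_sets_at i G k.+1| + #|neg_sets_at i G k.+1|)%N = 'C(#|G|.-1, k).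
Proof.
move=> iG; rewrite -(card_draws_mem k iG).
rewrite -[RHS](cardsID (nneg_sets_at i G k.+1)); congr addn; apply: eq_card => A;
  rewrite !inE.
  by case: (i \in A); case: (A \subset G); case: (_ == _).
by rewrite ltNge; case: (i \in A); case: (A \subset G); case: (_ == _); case: (0 <= _).
Qed.

Lemma card_nneg_setsD1 i G k : i \in G ->
  #|nneg_sets G k| = (#|nneg_sets_at i G k| + #|nneg_sets (G :\ i) k|)%N.
Proof.
move=> iG; rewrite -[LHS](cardsID [set S : {set T} | i \in S]).
congr addn; apply: eq_card => A; rewrite !inE.
  by rewrite andbC.
by rewrite subsetD1; case: (i \in A); rewrite /= ?andbF // andbT.
Qed.

Lemma nneg_setsS G G' k : G \subset G' -> nneg_sets G k \subset nneg_sets G' k.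
Proof.
move=> sGG'; apply/subsetP => S; rewrite !inE => /and3P[sS -> ->].
by rewrite (subset_trans sS).
Qed.

Lemma sumr_setD A G : A \subset G ->
  \sum_(i in G) x i = \sum_(i in A) x i + \sum_(i in G :\: A) x i.
Proof.
move=> sAG; rewrite (big_setID A) /=; congr (_ + _).
by rewrite (setIidPr sAG).
Qed.

(** Discard a smallest element [r] times. If it is positive, so is everything that remains;
    otherwise discarding it does not lower the sum. *)
Lemma nneg_sum_subset B r : (r <= #|B|)%N -> 0 <= \sum_(i in B) x i ->
  exists G, [/\ G \subset B, #|G| = (#|B| - r)%N & 0 <= \sum_(i in G) x i].
Proof.
elim: r => [|r IH] rB sB; first by exists B; rewrite subn0.
have [G [sGB cG sG]] := IH (ltnW rB) sB.
have [G0|[j jG]] := set_0Vmem G; first by move: cG; rewrite G0 cards0; lia.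
have [i iG imin] := arg_minP x jG.
have {}iG : i \in G by [].
exists (G :\ i); split.
- exact: subset_trans (subsetDl _ _) sGB.
- by have := cardsD1 i G; rewrite iG cG; lia.
have [xi|xi] := ltP 0 (x i).
  apply: sumr_ge0 => l; rewrite !inE => /andP[_ lG].
  exact: le_trans (ltW xi) (imin l lG).
by move: sG; rewrite (big_setD1 i) //=; lra.
Qed.

Lemma card_nneg_sets_mul q k G : #|G| = (q.+1 * k.+1)%N ->
  0 <= \sum_(i in G) x i -> ('C(#|G|.-1, k) <= #|nneg_sets G k.+1|)%N.
Proof.
elim: q G => [|q IH] G cG sG.
  rewrite cG mul1n /= binn card_gt0; apply/set0Pn; exists G.
  by rewrite inE subxx cG mul1n eqxx.
have [G0|[i iG]] := set_0Vmem G; first by move: cG; rewrite G0 cards0; lia.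
(* Both counts include the nonnegative sets through [i]. Cancelling them leaves negative sets
   through [i] against nonnegative sets avoiding [i]. *)
rewrite -(card_nneg_neg_at k iG) (card_nneg_setsD1 _ iG) leq_add2l.
set N := neg_sets_at _ _ _; set F := nneg_sets _ _.
set c := 'C((q.+1 * k.+1).-1, k).
have c0 : (0 < c)%N by rewrite bin_gt0; lia.
(* Both sides bound the number of disjoint pairs in [N * F]. *)
rewrite -(leq_pmul2r c0).
(* Removing a negative [A] keeps the sum nonnegative and lowers the quotient by one. Sets inside
   [G :\: A] avoid [i] because [A] contains it. *)
have lower A : A \in N -> (c <= \sum_(S in F) [disjoint A & S])%N.
  rewrite inE => /and4P[iA sAG /eqP cA sA].
  have cGA : #|G :\: A| = (q.+1 * k.+1)%N by rewrite cardsDS // cG cA; lia.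
  have sGA : 0 <= \sum_(l in G :\: A) x l by move: sG; rewrite (sumr_setD sAG); lra.
  have := IH _ cGA sGA; rewrite cGA -/c => /leq_trans; apply.
  rewrite -sum1_card [leqRHS](big_setID (nneg_sets (G :\: A) k.+1)) /=.
  apply: leq_trans (leq_addr _ _); apply/eq_leq/esym.
  rewrite (setIidPr _).
    apply: eq_bigr => S; rewrite inE subsetD => /and3P[/andP[_ dSA] _ _].
    by rewrite disjoint_sym dSA.
  by apply: nneg_setsS; apply: setDS; rewrite sub1set.
(* Here the sign of [A] is forgotten: all [k.+1]-sets through [i] inside [G :\: S] are counted. *)
have upper S : S \in F -> (\sum_(A in N) [disjoint A & S] <= c)%N.
  rewrite inE subsetD1 => /and3P[/andP[sSG iS] /eqP cS _].
  have iGS : i \in G :\: S by rewrite inE iS.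
  have cGS : #|G :\: S| = (q.+1 * k.+1)%N by rewrite cardsDS // cG cS; lia.
  rewrite /c -cGS -(card_draws_mem k iGS).
  rewrite (eq_bigr (fun A => if [disjoint A & S] then 1 else 0)%N) => [|A _];
    last by case: [disjoint _ & _].
  rewrite -big_mkcondr sum1dep_card; apply/subset_leq_card/subsetP => A.
  by rewrite !inE subsetD => /andP[/and4P[-> -> -> _] ->].
rewrite -sum_nat_const; apply: leq_trans (leq_sum _ lower) _.
rewrite exchange_big /= -sum_nat_const; exact: leq_sum.
Qed.

(** Markov's inequality with weights [y j = x i - x j]: a negative [A] has weight at least
    [k.+2 * x i], while all sets of [D] together weigh at most [#|G| * c * x i]. When [x i] is
    positive it can be cancelled. *)
Lemma card_neg_sets_at_max i G k : i \in G -> {in G, forall j, x j <= x i} ->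
  0 <= \sum_(j in G) x j ->
  (#|neg_sets_at i G k.+2| * k.+2 <= #|G| * 'C(#|G| - 2, k))%N.
Proof.
move=> iG imax sG; set N := neg_sets_at _ _ _; set c := 'C(_, _).
have [xi|xi] := leP (x i) 0.
  (* With no positive value, the complement of a negative set cannot restore a nonnegative total. *)
  have -> : N = set0; last by rewrite cards0.
  apply/setP => A; rewrite !inE; apply/negP => /and4P[_ sAG _ sA].
  have : \sum_(j in G :\: A) x j <= 0.
    apply: sumr_le0 => j; rewrite inE => /andP[_ jG].
    exact: le_trans (imax j jG) xi.
  by move: sG; rewrite (sumr_setD sAG); lra.
pose y j := x i - x j.
pose D := [set A : {set T} | [&& i \in A, A \subset G & #|A| == k.+2]].
have y0 A j : A \in D -> j \in A -> 0 <= y j.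
  rewrite inE => /and3P[_ /subsetP sAG _] jA.
  by rewrite subr_ge0; apply/imax/sAG.
have sND : N \subset D by apply/subsetP => A; rewrite !inE => /and4P[-> -> ->].
have lower : (#|N| * k.+2)%:R * x i <= \sum_(A in N) \sum_(j in A) y j.
  rewrite natrM -mulrA mulr_natl -sumr_const; apply: ler_sum => A.
  rewrite inE => /and4P[_ _ /eqP cA sA].
  by rewrite sumrB sumr_const cA mulr_natl lerDl oppr_ge0 ltW.
have upper : \sum_(A in N) \sum_(j in A) y j <= \sum_(A in D) \sum_(j in A) y j.
  rewrite [leRHS](big_setID N) /= (setIidPr sND) lerDl.
  apply: sumr_ge0 => A; rewrite inE => /andP[_ AD].
  by apply: sumr_ge0 => j; apply: y0 AD.
have total : \sum_(A in D) \sum_(j in A) y j = c%:R * \sum_(j in G) y j.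
  rewrite (exchange_big_dep (mem G)) /=; last first.
    by move=> A j; rewrite inE => /and3P[_ /subsetP sAG _]; apply: sAG.
  (* The element [i] lies in every set of [D] but has weight zero; any other [j] lies in exactly [c]
     of them. *)
  rewrite mulr_sumr; apply: eq_bigr => j jG.
  have [<-|nij] := eqVneq i j; first by rewrite /y subrr mulr0 big1.
  rewrite mulr_natl /c -(card_draws_mem2 k iG jG nij) -sumr_const.
  apply: eq_bigl => A; rewrite !inE.
  by case: (i \in A); case: (j \in A); rewrite ?andbT ?andbF.
have bound : (#|N| * k.+2)%:R * x i <= (#|G| * c)%:R * x i.
  apply: le_trans lower (le_trans upper _).
  rewrite total sumrB sumr_const natrM mulrBr -[x i *+ _]mulr_natl mulrCA mulrA.
  by rewrite gerBl mulr_ge0.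
by rewrite -(ler_nat R) -(ler_pM2r xi).
Qed.

End NonnegativeSums.

(** Pascal's rule applied [a.+1] times; each increment is at most the last one, ['C(m + a, k)]. *)
Lemma leq_bin_addl m a k : ('C(m + a.+1, k.+1) <= 'C(m, k.+1) + a.+1 * 'C(m + a, k))%N.
Proof.
elim: a => [|a IH]; first by rewrite addn1 addn0 binS mul1n.
rewrite addnS binS mulSn addnCA addnC leq_add2l.
by apply: (leq_trans IH); rewrite leq_add2l leq_mul2l leq_bin2l ?orbT // leq_add2l.
Qed.

Lemma mul_bin_leq_of_cube n m k : (2 * k.+2 ^ 3 <= n)%N -> (n - 2 * k.+2 <= m)%N ->
  (n * 'C(n - 2, k) <= k.+2 * 'C(m, k.+1))%N.
Proof.
move=> hn hm; apply: leq_trans (leq_mul (leqnn _) (leq_bin2l k.+1 hm)).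
have := leq_bin_addl (n - 2 * k.+2) (2 * k.+1) k.
(* This is the bound that [h4] needs; with [K = k.+2] its left side is [K * (2K^2 - 3K + 2)], at
   most [2K^3]. *)
have hn1 : (k.+2 * (1 + k.+1 * (2 * k.+1).+1) <= n)%N by move: hn; nia.
have e1 : (n - 2 * k.+2 + (2 * k.+1).+1 = (n - 2).+1)%N by nia.
have e2 : (n - 2 * k.+2 + 2 * k.+1 = n - 2)%N by nia.
have e3 : ((n - 2).+1 = n - 1)%N by nia.
have e4 : ((n - 1).-1 = n - 2)%N by lia.
have := mul_bin_diag (n - 1) k; rewrite e4 e1 e2 e3.
set b := 'C(n - 2, k); set b' := 'C(n - 1, _); set c := 'C(_, _) => h1 h2.
rewrite -(leq_pmul2l (ltn0Sn k)).
have h3 : ((n - 1) * b <= k.+1 * c + k.+1 * (2 * k.+1).+1 * b)%N.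
  by rewrite h1 -mulnA -mulnDr leq_pmul2l.
have h4 : (k.+1 * n + k.+2 * (k.+1 * (2 * k.+1).+1) <= k.+2 * (n - 1))%N.
  by move: hn1; rewrite mulnBr muln1 [(k.+2 * n)%N]mulSn mulnDr muln1; lia.
have h5 := leq_mul h4 (leqnn b).
have h6 := leq_mul (leqnn k.+2) h3.
by nia.
Qed.

Theorem theorem2p3 (R : realType) (n k : nat) (hn : (0 < n)%N) (hk : (0 < k)%N)
    (hnk : (2 * k ^ 3 <= n)%N) (x : 'I_n -> R) (hx : 0 <= \sum_(i < n) x i) :
  ('C(n - 1, k - 1) <=
     #|[set S : {set 'I_n} | (#|S| == k) && ((0 : R) <= \sum_(i in S) x i)%R]|)%N.
Proof.
have -> : [set S : {set 'I_n} | (#|S| == k) && (0 <= \sum_(i in S) x i)]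
    = nneg_sets x [set: 'I_n] k.
  by apply/setP => S; rewrite !inE subsetT.
have hxT : 0 <= \sum_(i in [set: 'I_n]) x i.
  by rewrite (eq_bigl predT) // => i; rewrite inE.
have cT : #|[set: 'I_n]| = n by rewrite cardsT card_ord.
have [i _ imax] := arg_maxP x (isT : predT (Ordinal hn)).
have iT : i \in [set: 'I_n] by rewrite inE.
(* The maximum is at least the average. *)
have xi0 : 0 <= x i.
  rewrite -(pmulrn_lge0 _ hn); apply: le_trans hx _.
  rewrite -[X in _ *+ X]card_ord -sumr_const.
  by apply: ler_sum => j _; apply: imax.
case: k hk hnk => // k _ hnk.
rewrite (card_nneg_setsD1 _ _ iT) subn1 subSS subn0 -{1}cT.
rewrite -(card_nneg_neg_at x k iT) leq_add2l.
have [->|[A]] := set_0Vmem (neg_sets_at x i [set: 'I_n] k.+1).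
  by rewrite cards0.
rewrite inE => /and4P[iA _ /eqP cA sA].
(* Sets of size one are treated apart, since the Markov bound needs size at least two: the negative
   set would be the singleton of [i]. *)
case: k => [|k] in hnk cA *.
  move/eqP/cards1P: cA iA sA => [j ->]; rewrite inE => /eqP <-.
  by rewrite big_set1 ltNge xi0.
have cB : #|[set: 'I_n] :\: A| = (n - k.+2)%N by rewrite cardsDS ?subsetT // cT cA.
have sB : 0 <= \sum_(j in [set: 'I_n] :\: A) x j.
  by move: hxT; rewrite (sumr_setD x (subsetT A)); lra.
pose q := (#|[set: 'I_n] :\: A| %/ k.+2)%N.
pose r := (#|[set: 'I_n] :\: A| %% k.+2)%N.
have [G [sGB cG sG]] := nneg_sum_subset (leq_mod _ _ : (r <= _)%N) sB.
have dB := divn_eq #|[set: 'I_n] :\: A| k.+2; rewrite -/q -/r in dB.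
have lr : (r < k.+2)%N by rewrite ltn_mod.
have n3 : (3 * k.+2 <= n)%N.
  apply: leq_trans hnk; rewrite expnS mulnCA mulnC leq_pmul2l //.
  by clear; rewrite expnS expn1; lia.
have q0 : (0 < q)%N by rewrite divn_gt0 // cB; clear -n3; lia.
have cG' : #|G| = (q.-1.+1 * k.+2)%N by rewrite prednK // cG dB addnK.
have sGT : G \subset [set: 'I_n] :\ i.
  by apply: subset_trans sGB _; apply: setDS; rewrite sub1set.
apply: leq_trans _ (subset_leq_card (nneg_setsS x _ sGT)).
apply: leq_trans _ (card_nneg_sets_mul cG' sG).
rewrite -(leq_pmul2l (ltn0Sn k.+1)) mulnC.
have himax : {in [set: 'I_n], forall j, x j <= x i} by move=> j _; apply: imax.
apply: (leq_trans (card_neg_sets_at_max k iT himax hxT)); rewrite cT.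
(* As [r] is at most [k.+1], [G] keeps at least [n - 2 * k.+2 + 1] elements, which pays for the
   predecessor in ['C(#|G|.-1, k.+1)]. *)
apply: mul_bin_leq_of_cube hnk _; rewrite cG' prednK //.
by clear -cB dB lr n3; lia.
Qed.
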